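(* Let $\{p_\theta\mid\theta\in\Theta\}$ be a family of probability densities and let $\theta\in\Theta$. Let $g$, $I^s_{g,\theta}$, $\kappa$ and $\alpha_1(\theta)$ be as defined in the context. If the convergence $$\frac{I^s(p_{\theta-\epsilon/2}\|p_{\theta+\epsilon/2})}{g(\epsilon)}\longrightarrow I^s_{g,\theta}\qquad(\epsilon\to+0)$$ is uniform for $0<s<1$, then $$\alpha_1(\theta)\le\overline{\alpha}_1(\theta):=2^{\kappa}\sup_{0<s<1}I^s_{g,\theta}.$$
   Context: $\Theta\subset\mathbb{R}$ is an open interval and $\{p_\theta\mid\theta\in\Theta\}$ is a family of probability densities on a measurable space $\Omega$ with respect to a common reference measure; $p_\theta^n$ denotes the distribution of $n$ i.i.d. observations from $p_\theta$. An estimator is a sequence $\vec T=\{T_n\}$ of measurable functions $T_n:\Omega^n\to\mathbb{R}$ (no consistency is required). Relative Rényi entropy: for $0<s<1$, $I^s(p\|q):=-\log\int p^s(\omega)q^{1-s}(\omega)\,d\omega$. Exponential rate: for $\epsilon>0$, $$\beta(\vec T,\theta,\epsilon):=\liminf_{n\to\infty}\frac{-1}{n}\log p_\theta^n\{|T_n-\theta|>\epsilon\}\qquad(-\log 0=\infty).$$ Standing assumptions: $g:[0,\infty)\to[0,\infty)$ is strictly monotonically increasing with $g(0)=0$ and has the same order as $I^s(p_\theta\|p_{\theta+\epsilon})$ as $\epsilon\to+0$; the finite limits $$I^s_{g,\theta}:=\lim_{\epsilon\to+0}\frac{I^s(p_{\theta-\epsilon/2}\|p_{\theta+\epsilon/2})}{g(\epsilon)}$$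 exist; and $\kappa>0$ is the real number such that $\lim_{\epsilon\to+0}g(x\epsilon)/g(\epsilon)=x^\kappa$ for all $x>0$ (this limit is assumed to exist). Definition: $$\alpha_1(\theta):=\limsup_{\epsilon\to+0}\frac{1}{g(\epsilon)}\sup_{\vec T}\inf_{\theta-\epsilon\le\theta'\le\theta+\epsilon}\beta(\vec T,\theta',\epsilon),$$ the supremum being over all estimators.
   Formalization: The deviation event in β is taken as |T_n − θ| ≥ ε instead of > ε; with the strict event the constant estimator T_n = θ makes α_1(θ) = ∞ for every family, so the claimed bound fails, e.g. for the Gaussian location family. *)

(* Defs.v *)
From HB Require Import structures.
From mathcomp Require Export all_boot all_order all_algebra.
From mathcomp Require Export all_classical all_reals all_analysis measurable_realfun.

Set Implicit Arguments.
Unset Strict Implicit.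
Unset Printing Implicit Defensive.

Export Order.TTheory GRing.Theory Num.Theory.
Export numFieldNormedType.Exports.

Global Open Scope classical_set_scope.
Global Open Scope ring_scope.

Section density.
Context d (Omega : measurableType d) (R : realType).
Variable mu : {measure set Omega -> \bar R}.

Record density := Density {
  pdf :> Omega -> R ;
  pdf_measurable : measurable_fun setT pdf ;
  pdf_ge0 : forall w, 0 <= pdf w ;
  pdf_integral : (\int[mu]_w (pdf w)%:E = 1)%E }.

Definition density_law (p : density) (A : set Omega) : \bar R :=
  (\int[mu]_(w in A) (p w)%:E)%E.

Section density_law_probability.
Variable p : density.

Let law0 : density_law p set0 = 0%E.
Proof. by rewrite /density_law integral_set0. Qed.

Let law_ge0 A : (0 <= density_law p A)%E.
Proof. by apply: integral_ge0 => w _; rewrite lee_fin pdf_ge0. Qed.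

Let law_sigma_additive : semi_sigma_additive (density_law p).
Proof.
move=> F mF tF mUF; rewrite /density_law ge0_integral_bigcup//=.
- by apply: is_cvg_ereal_nneg_natsum_cond => n _ _; exact: law_ge0.
- by apply/measurable_EFinP/measurable_funTS; exact: pdf_measurable.
- by move=> w _; rewrite lee_fin pdf_ge0.
Qed.

HB.instance Definition _ := isMeasure.Build _ _ _ (density_law p)
  law0 law_ge0 law_sigma_additive.

Let law_setT : density_law p setT = 1%E.
Proof. exact: pdf_integral. Qed.

HB.instance Definition _ := Measure_isProbability.Build _ _ _ (density_law p)
  law_setT.

End density_law_probability.

Definition renyi (s : R) (p q : density) : \bar R :=
  (- lne (\int[mu]_w (p w `^ s * q w `^ (1 - s))%:E))%E.

End density.

Section iid.
Context d (Omega : measurableType d) (R : realType).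

Definition tuple_cons n (x : Omega * n.-tuple Omega) : n.+1.-tuple Omega :=
  [tuple of x.1 :: x.2].

Let measurable_tuple_cons n : measurable_fun setT (@tuple_cons n).
Proof. by apply: measurable_cons; [exact: measurable_fst|exact: measurable_snd]. Qed.

HB.instance Definition _ n :=
  isMeasurableFun.Build _ _ _ _ (@tuple_cons n) (@measurable_tuple_cons n).

(* The n-fold product P \x ... \x P, carried by n.-tuple Omega with its product
   sigma-algebra; each step transports P \x P^n along (x, t) |-> x :: t. *)
Fixpoint iid (P : probability Omega R) n : probability (n.-tuple Omega) R :=
  match n with
  | 0 => \d_([tuple] : 0.-tuple Omega)
  | m.+1 => distribution (P \x iid P m)%E (@tuple_cons m)
  end.

End iid.

Section exponential_rate.
Context d (Omega : measurableType d) (R : realType).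
Variable mu : {measure set Omega -> \bar R}.
Variable p : R -> density mu.

Definition estimator := forall n, {mfun n.-tuple Omega >-> R}.

(* The liminf, as n -> oo, of - (1/n) log p_theta^n {|T_n - theta| >= eps}.
   The deviation event is closed (>=), not the open one {|T_n - theta| > eps}:
   with the open event alpha1 below is +oo for every family, because the constant
   estimator T_n := theta satisfies |T_n - theta'| <= eps surely for all theta'
   in [theta - eps, theta + eps], and the upper bound on alpha1 would fail, e.g.
   for Gaussian location families.  lne 0 = -oo encodes - log 0 = oo. *)
Definition beta (T : estimator) (theta eps : R) : \bar R :=
  limn_einf (fun n => ((n%:R^-1)%:E *
    - lne (iid (density_law (p theta)) n
             [set w | (eps <= `|T n w - theta|)%R]))%E).

Definition alpha1 (g : R -> R) (theta : R) : \bar R :=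
  limf_esup (fun eps => ((g eps)^-1%:E *
    ereal_sup [set ereal_inf [set beta T theta' eps |
                                theta' in `[(theta - eps)%R, (theta + eps)%R]]
              | T in [set: estimator]])%E) 0^'+.

End exponential_rate.

(* Main.v *)
Require Import Defs.
From mathcomp Require Import ring lra.

(** Test the two endpoints [theta - eps] and [theta + eps] against each other.
    An estimate cannot be within [eps] of both, so the two deviation events
    cover the sample space, and an estimator whose error probabilities at both
    endpoints decayed like [expR (- c * n)] would be a test between
    [P = p (theta - eps)] and [Q = p (theta + eps)] with both errors that
    small.  The converse half of Chernoff's theorem forbids this when [c]
    exceeds the Chernoff information, the supremum over [0 < s < 1] of
    [renyi s P Q].  Hence the infimum of the rates is at most that supremum.
    The two points are [2 * eps] apart, so uniform convergence bounds the
    supremum by [g (2 * eps) * (sup Ig + delta)], and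
    [g (2 * eps) / g eps --> 2 `^ kappa] gives the constant.

    The converse is obtained without laws of large numbers.  Let [M s] be the
    integral of [p ^ s * q ^ (1 - s)], so that the Chernoff information is
    [- ln (inf M)], and let [K, L >= 1].  Splitting according to the size of
    the likelihood ratio bounds [p ^ s * q ^ (1 - s)] by
    [(K ^ s + L ^ (1 - s)) * min p q] plus small multiples of the same
    expression at exponents [t' < s < t] ([gmean_split2]).  Integrated over
    [n] observations, with [K ^ n] and [L ^ n] for [K] and [L], this bounds
    [M s ^ n] by the sum of the two errors, times an exponential factor, plus
    [(M t / K ^ (t - s)) ^ n + (M t' / L ^ (s - t')) ^ n]
    ([affinity_iid_le]).  If the errors are too small, one of the last two
    terms must dominate, so that near each [s] the function [M] grows
    exponentially to the right or to the left ([affinity_growth]).  At a point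
    where [M] is almost minimal this is a linear increase over a distance
    [h], whereas the second difference of [M] is quadratic in [h]
    ([gmean_convex4], [no_two_sided_growth]). *)

Set Implicit Arguments.
Unset Strict Implicit.
Unset Printing Implicit Defensive.

(** * Weighted geometric means *)

Section gmean.
Context {R : realType}.
Implicit Types x y s t h K L : R.

Definition gmean s x y : R := x `^ s * y `^ (1 - s).

Lemma gmean_ge0 s x y : 0 <= gmean s x y.
Proof. by rewrite mulr_ge0 ?powR_ge0. Qed.

Lemma gmeanC s x y : gmean s x y = gmean (1 - s) y x.
Proof. by rewrite /gmean mulrC; congr (_ * _ `^ _); lra. Qed.

Lemma gmeanxx s x : 0 <= x -> gmean s x x = x.
Proof.
move=> x0; rewrite /gmean -powRD; last by rewrite subrKC oner_eq0.
by rewrite subrKC powRr1.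
Qed.

Lemma gmean0 x y : 0 <= y -> gmean 0 x y = y.
Proof. by move=> y0; rewrite /gmean powRr0 subr0 powRr1// mul1r. Qed.

Lemma gmean1 x y : 0 <= x -> gmean 1 x y = x.
Proof. by move=> x0; rewrite gmeanC subrr gmean0. Qed.

Lemma gmeanM s x y x' y' : 0 <= x -> 0 <= y -> 0 <= x' -> 0 <= y' ->
  gmean s (x * x') (y * y') = gmean s x y * gmean s x' y'.
Proof. by move=> *; rewrite /gmean !powRM//; ring. Qed.

(** The weighted mean lies below the larger of [x] and [y]. *)
Lemma gmean_leD s x y : 0 <= x -> 0 <= y -> 0 <= s <= 1 ->
  gmean s x y <= x + y.
Proof.
wlog yx : s x y / y <= x => [hw x0 y0 s01|x0 y0 /andP[s0 s1]].
  have [yx|/ltW xy] := leP y x; first exact: hw.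
  by rewrite gmeanC (addrC x); apply: hw => //; lra.
apply: (@le_trans _ _ (gmean s x x)); last by rewrite gmeanxx// lerDl.
by rewrite ler_wpM2l ?powR_ge0// ge0_ler_powR// ?subr_ge0// nnegrE.
Qed.

(** If [x <= K * y] the mean is compared with [y] alone.  Otherwise
    [x / y > K], and passing to the larger exponent [t] gains the factor
    [(x / y) `^ (t - s)], which exceeds [K `^ (t - s)]. *)
Lemma gmean_split s t x y K : 0 <= y -> y <= x -> 1 <= K -> 0 < s < 1 -> s <= t ->
  gmean s x y <= K `^ s * y + gmean t x y / K `^ (t - s).
Proof.
move=> y0 yx K1 /andP[s0 s1] st.
have K0 : 0 < K by lra.
have gt0 := gmean_ge0 t x y.
move: y0; rewrite le_eqVlt => /predU1P[<-|y0].
  rewrite {1}/gmean powR0 ?subr_eq0 ?gt_eqF// mulr0.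
  by rewrite addr_ge0 ?mulr_ge0 ?invr_ge0 ?powR_ge0.
have x0 : 0 < x by lra.
have Ky0 : 0 <= K * y by rewrite mulr_ge0 ?ltW.
have [xK|/ltW Kx] := leP x (K * y).
  rewrite ler_wpDr ?divr_ge0 ?powR_ge0//.
  rewrite -{2}(gmeanxx s (ltW y0)) /gmean mulrA -powRM ?(ltW K0) ?(ltW y0)//.
  by rewrite ler_wpM2r ?powR_ge0// ge0_ler_powR ?nnegrE ?(ltW x0) ?(ltW s0).
rewrite ler_wpDl ?mulr_ge0 ?powR_ge0 ?(ltW y0)// ler_pdivlMr ?powR_gt0//.
have yE : y `^ (1 - s) = y `^ (1 - t) * y `^ (t - s).
  by rewrite -powRD ?(gt_eqF y0) ?implybT//; congr (_ `^ _); lra.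
have xE : x `^ t = x `^ s * x `^ (t - s).
  by rewrite -powRD ?(gt_eqF x0) ?implybT//; congr (_ `^ _); lra.
rewrite /gmean yE xE.
have Kyx : K `^ (t - s) * y `^ (t - s) <= x `^ (t - s).
  rewrite -powRM ?(ltW K0) ?(ltW y0)//.
  by rewrite ge0_ler_powR ?nnegrE ?subr_ge0 ?(ltW x0).
have := ler_wpM2l (mulr_ge0 (powR_ge0 x s) (powR_ge0 y (1 - t))) Kyx.
by congr (_ <= _); ring.
Qed.

(** The pointwise truncation behind the converse: with [x] and [y] the two
    likelihoods, [Num.min x y] integrates to at most the total error of any
    test, and the remaining terms cover likelihood ratios above [K] or below
    [1 / L]. *)
Lemma gmean_split2 s t t' x y K L : 0 <= x -> 0 <= y -> 1 <= K -> 1 <= L ->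
  0 < s < 1 -> s <= t -> t' <= s ->
  gmean s x y <= (K `^ s + L `^ (1 - s)) * Num.min x y
    + gmean t x y / K `^ (t - s) + gmean t' x y / L `^ (s - t').
Proof.
(* Exchanging x and y turns s into 1 - s, hence exchanges t with t', K with L. *)
wlog yx : s t t' x y K L / y <= x => [hw x0 y0 K1 L1 s01 st t's|].
  have /orP[yx|xy] := le_total y x; first exact: hw.
  have s01' : 0 < 1 - s < 1 by lra.
  have := hw (1 - s) (1 - t') (1 - t) y x L K xy y0 x0 L1 K1 s01'.
  rewrite -!gmeanC minC [L `^ _ + _]addrC.
  have -> : 1 - t' - (1 - s) = s - t' by ring.
  have -> : 1 - (1 - s) = s by ring.
  have -> : 1 - s - (1 - t) = t - s by ring.
  by rewrite addrAC; apply; lra.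
move=> x0 y0 K1 L1 s01 st t's; rewrite min_r//.
apply: le_trans (gmean_split y0 yx K1 s01 st) _.
have := gmean_ge0 t' x y; have := gmean_ge0 t x y; move=> *.
rewrite mulrDl -!addrA lerD2l addrCA lerDl.
by rewrite addr_ge0 ?mulr_ge0 ?invr_ge0 ?powR_ge0.
Qed.

(** With [v = x `^ h] and [w = y `^ h], the difference of the two sides is a
    nonnegative multiple of [(v - w) ^+ 4].  Read as a bound on second
    differences, it says that halving the step divides them by at least
    four. *)
Lemma gmean_convex4 s h x y : 0 <= x -> 0 <= y -> 0 < h ->
  0 <= s - h *+ 2 -> s + h *+ 2 <= 1 ->
  4 * (gmean (s + h) x y + gmean (s - h) x y)
    <= gmean (s + h *+ 2) x y + gmean (s - h *+ 2) x y + 6 * gmean s x y.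
Proof.
rewrite mulr2n => x0 y0 h0 sl sr.
have rhs0 : 0 <= gmean (s + (h + h)) x y + gmean (s - (h + h)) x y
    + 6 * gmean s x y.
  have := gmean_ge0 (s + (h + h)) x y; have := gmean_ge0 s x y.
  by have := gmean_ge0 (s - (h + h)) x y; lra.
move: x0; rewrite le_eqVlt => /predU1P[x0|x0].
  have gm u : u != 0 -> gmean u x y = 0.
    by rewrite -x0 /gmean => ?; rewrite powR0// mul0r.
  by rewrite (gm (s + h)) ?(gm (s - h)) ?gt_eqF//; lra.
move: y0; rewrite le_eqVlt => /predU1P[y0|y0].
  have gm u : 1 - u != 0 -> gmean u x y = 0.
    by rewrite -y0 /gmean => ?; rewrite powR0// mulr0.
  by rewrite (gm (s + h)) ?(gm (s - h)) ?gt_eqF//; lra.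
(* All five means are monomials of degree 4 in v and w, times z. *)
pose z := x `^ (s - (h + h)) * y `^ (1 - s - (h + h)).
pose v := x `^ h; pose w := y `^ h.
have powX (c : R) (n : nat) : 0 <= c -> c `^ (h *+ n) = c `^ h ^+ n.
  by move=> c0; rewrite -powR_mulrn ?powR_ge0// -powRrM mulr_natr.
have gE (j : nat) : (j <= 4)%N ->
    gmean (s - (h + h) + h *+ j) x y = z * v ^+ j * w ^+ (4 - j).
  move=> j4; rewrite /gmean /z /v /w -!powX ?ltW//.
  rewrite powRD ?(gt_eqF x0) ?implybT//.
  rewrite -!mulrA; congr (_ * _); rewrite mulrCA; congr (_ * _).
  rewrite -powRD ?(gt_eqF y0) ?implybT//; congr (_ `^ _).
  by rewrite mulrnBr// (_ : h *+ 4 = 4 * h); [ring|rewrite mulr_natl].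
have -> : s + h = s - (h + h) + h *+ 3 by ring.
have -> : s - h = s - (h + h) + h *+ 1 by ring.
have -> : s + (h + h) = s - (h + h) + h *+ 4 by ring.
have -> : gmean s x y = gmean (s - (h + h) + h *+ 2) x y by congr gmean; ring.
have -> : gmean (s - (h + h)) x y = gmean (s - (h + h) + h *+ 0) x y.
  by rewrite addr0.
rewrite !gE// -subr_ge0.
rewrite [leRHS](_ : _ = z * (v - w) ^+ 2 ^+ 2); last first.
  by rewrite !(subn0, subnn)/= /subn/=; ring.
by rewrite mulr_ge0// ?sqr_ge0// mulr_ge0 ?powR_ge0.
Qed.

End gmean.

(** * Functions with a flat minimum *)

Lemma exprn_gt_bound {R : realType} (k c : R) : 1 < k -> exists n, c < k ^+ n.
Proof.
move=> k1; have [n cn] : exists n, c / (k - 1) < n%:R.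
  by exists (Num.truncn (c / (k - 1))).+1; exact: truncnS_gt.
exists n; apply: (@lt_le_trans _ _ (n%:R * (k - 1))).
  by rewrite -ltr_pdivrMr ?subr_gt0.
elim: n {cn} => [|n ih]; first by rewrite mul0r expr0.
rewrite exprS -natr1 mulrDl mul1r.
have kn1 : 1 <= k ^+ n by rewrite exprn_ege1 ?ltW.
nra.
Qed.

Section no_two_sided_growth.
Variables (R : realType) (M : R -> R) (a b B : R).
Hypotheses (a_gt0 : 0 < a) (ab : a < b).
Hypotheses (M0 : M 0 <= 1) (M1 : M 1 <= 1).
Hypothesis M_bounded : forall s : R, 0 <= s <= 1 -> 0 <= M s <= B.
Hypothesis M_ge : forall s : R, 0 < s < 1 -> b <= M s.
Hypothesis M_smooth : forall s h : R, 0 < h -> 0 <= s - h *+ 2 -> s + h *+ 2 <= 1 ->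
  4 * (M (s + h) + M (s - h)) <= M (s + h *+ 2) + M (s - h *+ 2) + 6 * M s.
Hypothesis M_growth : forall K L s t t' : R, 1 <= K -> 1 <= L -> 0 < s < 1 ->
  0 <= t' < s -> s < t <= 1 -> K `^ s * a < M s -> L `^ (1 - s) * a < M s ->
  K `^ (t - s) * M s <= M t \/ L `^ (s - t') * M s <= M t'.

Let gap s h := M (s + h) + M (s - h) - 2 * M s.

(** The second difference is at most quadratic in the step: iterating
    [M_smooth] along successive halvings. *)
Lemma gap_half s r n : 0 < r -> 0 <= s - r -> s + r <= 1 ->
  gap s (r / 2 ^+ n) * 4 ^+ n <= gap s r.
Proof.
move=> r0 sl sr; elim: n => [|n ih]; first by rewrite !expr0 divr1 mulr1.
apply: le_trans ih; rewrite [4 ^+ n.+1]exprS mulrA.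
rewrite ler_wpM2r ?exprn_ge0//.
set h := r / 2 ^+ n.+1.
have h0 : 0 < h by rewrite divr_gt0 ?exprn_gt0.
have h2 : r / 2 ^+ n = h *+ 2.
  by rewrite /h exprS invfM mulrCA mulrC -[RHS]mulr_natl; field; rewrite expf_neq0.
have hr : h *+ 2 <= r.
  by rewrite -h2 ler_pdivrMr ?exprn_gt0// ler_peMr ?(ltW r0)// exprn_ege1 ?ler1n.
have sl2 : 0 <= s - h *+ 2 by lra.
have sr2 : s + h *+ 2 <= 1 by lra.
by have := M_smooth h0 sl2 sr2; rewrite h2 /gap; lra.
Qed.

(** [M_growth] with [L = 1] and [K] so large that [M 1 <= 1] excludes growth to
    the right shows that [M] is nonincreasing near [0]; symmetrically it is
    nondecreasing near [1].  Hence the infimum of [M] over a compact subinterval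
    of the open unit interval is global, and at an almost minimal point there
    growth on one side is not compensated by a decrease on the other: the
    second difference at step [h] is at least linear in [h], contradicting
    [gap_half]. *)
Lemma no_two_sided_growth : False.
Proof.
have b0 : 0 < b := lt_trans a_gt0 ab.
(* Any k with 1 < k < b / a would do: k `^ s * a < b for all s <= 1. *)
pose k := (1 + b / a) / 2.
have ba1 : 1 < b / a by rewrite ltr_pdivlMr// mul1r.
have k1 : 1 < k by rewrite /k; lra.
have ka : k * a < b.
  by rewrite -ltr_pdivlMr// /k; lra.
have k0 : 0 < k := lt_trans ltr01 k1.
have [n kn] := exprn_gt_bound b^-1 k1.
pose N : R := n.+2%:R.
have N2 : 2 <= N by rewrite ler_nat.
have N0 : 0 < N by lra.
pose r := N^-1.
have r0 : 0 < r by rewrite invr_gt0.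
have r2 : r <= 2^-1 by rewrite lef_pV2 ?posrE.
(* For s <= 1 / N, K `^ s <= k while K `^ (1 - s) >= k ^+ n.+1 > 1 / b. *)
pose K := k `^ N.
have K1 : 1 <= K by rewrite -(powRr0 k) ler_powR ?ltW.
have Ks s : 0 < s <= r -> K `^ s * a < b /\ b^-1 < K `^ (1 - s).
  move=> /andP[s0 sr].
  have Ns : N * s <= 1 by rewrite mulrC -ler_pdivlMr// div1r.
  rewrite /K -!powRrM; split.
    apply: le_lt_trans ka; rewrite ler_wpM2r ?(ltW a_gt0)//.
    by rewrite -[leRHS]powRr1 ?(ltW k0)// ler_powR// ltW.
  apply: lt_le_trans kn _; rewrite -powR_mulrn ?(ltW k0)// ler_powR ?ltW//.
  by rewrite mulrBr mulr1 /N -natr1 -natr1; move: Ns; rewrite /N -!natr1; lra.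
have decr s t : 0 <= t < s -> s <= r -> M s <= M t.
  move=> ts sr; have /Ks[Ksa Kb] : 0 < s <= r by lra.
  have s01 : 0 < s < 1 by lra.
  have s1 : s < 1 <= (1 : R) by lra.
  have bs := M_ge s01.
  have := M_growth K1 (lexx (1 : R)) s01 ts s1 (lt_le_trans Ksa bs).
  rewrite !powR1 !mul1r => /(_ (lt_le_trans ab bs))[|//].
  move=> /le_trans/(_ M1); rewrite leNgt => /negP[].
  apply: (@lt_le_trans _ _ (K `^ (1 - s) * b)).
    by rewrite -ltr_pdivrMr// div1r.
  by rewrite ler_wpM2l ?powR_ge0.
have incr s t : s < t <= 1 -> 1 - r <= s -> M s <= M t.
  move=> st sr; have /Ks[Ksa] : 0 < 1 - s <= r by lra.
  rewrite opprB addrCA subrr addr0 => Kb.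
  have s01 : 0 < s < 1 by lra.
  have s0 : 0 <= (0 : R) < s by lra.
  have bs := M_ge s01.
  have := M_growth (lexx (1 : R)) K1 s01 s0 st _ (lt_le_trans Ksa bs).
  rewrite !powR1 !mul1r subr0 => /(_ (lt_le_trans ab bs))[//|].
  move=> /le_trans/(_ M0); rewrite leNgt => /negP[].
  apply: (@lt_le_trans _ _ (K `^ s * b)).
    by rewrite -ltr_pdivrMr// div1r.
  by rewrite ler_wpM2l ?powR_ge0.
pose S := [set M s | s in `[r, 1 - r]].
have Sr : S (M r) by exists r => //=; rewrite in_itv/=; lra.
have Sr' : S (M (1 - r)) by exists (1 - r) => //=; rewrite in_itv/=; lra.
have infS : has_inf S.
  split; first by exists (M r).
  exists 0 => _ [s /= + <-]; rewrite in_itv/= => sr.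
  by have /M_bounded/andP[] : 0 <= s <= 1 by lra.
have inf_le t : 0 <= t <= 1 -> inf S <= M t.
  move=> t01; have [tr|rt] := ltP t r.
    apply: le_trans (decr r t _ _); [|lra|by []].
    exact: ge_inf infS.2 _ Sr.
  have [rt'|tr'] := ltP (1 - r) t.
    apply: le_trans (incr (1 - r) t _ _); [|lra|by []].
    exact: ge_inf infS.2 _ Sr'.
  by apply: ge_inf infS.2 _ _; exists t => //=; rewrite in_itv/= rt.
have lnk : 0 < ln k by rewrite ln_gt0.
(* j makes the quadratic upper bound smaller than the linear lower bound. *)
have [j jlarge] := exprn_gt_bound (4 * B / (r * ln k * b)) (ltr1n R 2).
pose h := r / 2 ^+ j.
have h0 : 0 < h by rewrite divr_gt0 ?exprn_gt0.
have hr : h <= r.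
  by rewrite ler_pdivrMr ?exprn_gt0// ler_peMr ?(ltW r0)// exprn_ege1 ?ler1n.
(* Half of h * ln k * b, which is at most the growth k `^ h * M s - M s. *)
pose e := h * ln k * b / 2.
have e0 : 0 < e by rewrite !mulr_gt0.
have [_ [s /= + <-] Ms] := inf_adherent e0 infS.
rewrite in_itv/= => /andP[rs sr].
have s01 : 0 < s < 1 by lra.
have bs := M_ge s01.
have kh : 1 + h * ln k <= k `^ h by rewrite /powR gt_eqF// expR_ge1Dx.
have gaple : e <= gap s h.
  rewrite /gap.
  have l1 : inf S <= M (s + h) by apply: inf_le; lra.
  have l2 : inf S <= M (s - h) by apply: inf_le; lra.
  have hM : e *+ 2 <= (k `^ h - 1) * M s.
    rewrite /e mulr2n -splitr; apply: (@le_trans _ _ (h * ln k * M s)).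
      by rewrite ler_wpM2l// mulr_ge0 ?ltW.
    by rewrite ler_wpM2r//; lra.
  have hs : k `^ s * a < M s.
    apply: lt_le_trans bs; apply: le_lt_trans ka; rewrite ler_wpM2r ?(ltW a_gt0)//.
    by rewrite -[leRHS]powRr1 ?(ltW k0)// ler_powR ?ltW//; lra.
  have hs' : k `^ (1 - s) * a < M s.
    apply: lt_le_trans bs; apply: le_lt_trans ka; rewrite ler_wpM2r ?(ltW a_gt0)//.
    by rewrite -[leRHS]powRr1 ?(ltW k0)// ler_powR ?ltW//; lra.
  have hl : 0 <= s - h < s by lra.
  have hh : s < s + h <= 1 by lra.
  have := M_growth (ltW k1) (ltW k1) s01 hl hh hs hs'.
  have -> : s + h - s = h by ring.
  have -> : s - (s - h) = h by ring.
  by case; lra.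
have s_r0 : 0 <= s - r by lra.
have s_r1 : s + r <= 1 by lra.
have := gap_half j r0 s_r0 s_r1; rewrite -/h.
have gB : gap s r <= 2 * B.
  rewrite /gap.
  have /M_bounded/andP[_ ?] : 0 <= s + r <= 1 by lra.
  have /M_bounded/andP[_ ?] : 0 <= s - r <= 1 by lra.
  by lra.
apply/negP; rewrite -ltNge; apply: le_lt_trans gB _.
apply: lt_le_trans (_ : e * 4 ^+ j <= _); last by rewrite ler_wpM2r ?exprn_ge0.
have -> : e * 4 ^+ j = 2^-1 * (r * ln k * b) * 2 ^+ j.
  rewrite /e /h (_ : 4 = 2 * 2); last by rewrite -natrM.
  by rewrite exprMn; field; rewrite expf_neq0.
have p0 : 0 < r * ln k * b by rewrite !mulr_gt0.
move: jlarge; rewrite ltr_pdivrMr//; lra.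
Qed.

End no_two_sided_growth.

(** * Integration against product laws *)

Section density_law_integral.
Local Open Scope ereal_scope.
Context d (Omega : measurableType d) (R : realType).
Variables (mu : {measure set Omega -> \bar R}) (p : density mu).
Import HBNNSimple.

(** By monotone approximation by simple functions, for an arbitrary measure
    [mu]. *)
Lemma ge0_integral_density_law (f : Omega -> \bar R) :
  measurable_fun setT f -> (forall x, 0 <= f x) ->
  \int[density_law p]_x f x = \int[mu]_x (f x * (p x)%:E).
Proof.
move=> mf f0.
have mp : measurable_fun setT (EFin \o p).
  exact/measurable_EFinP/pdf_measurable.
pose h := nnsfun_approx measurableT mf.
have -> : \int[density_law p]_x f x =
    limn (fun n => \int[density_law p]_x (EFin \o h n) x).
  have fE x : f x = limn (fun n => (EFin \o h n) x).
    by apply/esym/cvg_lim => //; exact: cvg_nnsfun_approx.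
  under eq_integral do rewrite fE.
  apply: monotone_convergence => //.
  - by move=> n; apply/measurable_EFinP.
  - by move=> n x _ /=; rewrite lee_fin.
  - by move=> x _ a b ab; rewrite lee_fin; exact/lefP/nd_nnsfun_approx.
have -> : \int[mu]_x (f x * (p x)%:E) =
    limn (fun n => \int[mu]_x ((EFin \o h n) x * (p x)%:E)).
  have fE x : f x * (p x)%:E = limn (fun n => (EFin \o h n) x * (p x)%:E).
    apply/esym/cvg_lim => //; apply: cvgeZr => //.
    exact: cvg_nnsfun_approx.
  under eq_integral do rewrite fE.
  apply: monotone_convergence => //.
  - by move=> n; apply: emeasurable_funM => //; apply/measurable_EFinP.
  - by move=> n x _ /=; rewrite mule_ge0// lee_fin ?pdf_ge0.
  - move=> x _ a b ab/=; rewrite lee_wpmul2r ?lee_fin ?pdf_ge0//.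
    exact/lefP/nd_nnsfun_approx.
apply: congr_lim; apply/funext => n.
under [LHS]eq_integral do rewrite /= fimfunE -fsumEFin//.
rewrite ge0_integral_fsum//; last 2 first.
  - by move=> r; apply/measurable_EFinP; exact: measurable_funM.
  - by move=> r x _; exact: nnfun_muleindic_ge0.
under [RHS]eq_integral => x _.
  rewrite /= fimfunE -fsumEFin// ge0_mule_fsuml; last first.
    by move=> r; exact: nnfun_muleindic_ge0.
  over.
rewrite ge0_integral_fsum//; last 2 first.
  - move=> r; apply: emeasurable_funM => //.
    by apply/measurable_EFinP; exact: measurable_funM.
  - move=> r x _; apply: mule_ge0; first exact: nnfun_muleindic_ge0.
    by rewrite lee_fin pdf_ge0.
apply: eq_fsbigr => r rhn.
under [LHS]eq_integral do rewrite EFinM.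
rewrite integralZl_indic_nnsfun//= integral_indic// setIT.
under [RHS]eq_integral do rewrite EFinM -muleA.
have r0 : 0 <= r%:E by case/set_mem: rhn => t _ <-; rewrite lee_fin.
rewrite [RHS]ge0_integralZl//; last 2 first.
- by apply: emeasurable_funM => //; apply/measurable_EFinP.
- by move=> x _; rewrite mule_ge0 ?lee_fin ?pdf_ge0.
congr (_ * _); rewrite /= /density_law integral_mkcond.
apply: eq_integral => x _; rewrite patchE indicE.
by case: ifPn; rewrite ?mul1e ?mul0e.
Qed.

End density_law_integral.

Section iid_integral.
Local Open Scope ereal_scope.
Context d (Omega : measurableType d) (R : realType).
Implicit Types (P nu : probability Omega R).

Lemma measurable_tuple_cons n :
  measurable_fun setT (@tuple_cons d Omega n).
Proof. exact: measurable_funPT. Qed.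

Lemma ge0_integral_iidS P n (phi : n.+1.-tuple Omega -> \bar R) :
  measurable_fun setT phi -> (forall t, 0 <= phi t) ->
  \int[iid P n.+1]_t phi t =
  \int[P]_x \int[iid P n]_t phi [tuple of x :: t].
Proof.
move=> mphi phi0; rewrite /= ge0_integral_distribution// fubini_tonelli1//.
  by apply: measurableT_comp => //; exact: measurable_tuple_cons.
by move=> z /=.
Qed.

Definition likelihood n (f : Omega -> R) (t : n.-tuple Omega) : R :=
  (\prod_(x <- t) f x)%R.

Lemma likelihood_cons n f x (t : n.-tuple Omega) :
  likelihood f [tuple of x :: t] = (f x * likelihood f t)%R.
Proof. by rewrite /likelihood big_cons. Qed.

Lemma likelihood_ge0 n f (t : n.-tuple Omega) : (forall x, (0 <= f x)%R) ->
  (0 <= likelihood f t)%R.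
Proof. by move=> f0; exact: prodr_ge0. Qed.

Lemma measurable_likelihood n (f : Omega -> R) : measurable_fun setT f ->
  measurable_fun setT (@likelihood n f).
Proof.
move=> mf; rewrite (_ : likelihood f = fun t => \prod_(i < n) f (tnth t i))%R.
  apply: measurable_prod => i _.
  by apply: measurableT_comp => //; exact: measurable_tnth.
by apply/funext => t; rewrite /likelihood big_tuple.
Qed.

(** What makes weighted means suited to repeated observations: they are
    multiplicative. *)
Lemma likelihood_gmean n s f g (t : n.-tuple Omega) :
  (forall x, (0 <= f x)%R) -> (forall x, (0 <= g x)%R) ->
  likelihood (fun x => gmean s (f x) (g x)) t =
  gmean s (likelihood f t) (likelihood g t).
Proof.
move=> f0 g0; rewrite /likelihood; elim: (tval t) => [|x u ih].
  by rewrite !big_nil gmeanxx.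
by rewrite !big_cons gmeanM ?ih// prodr_ge0.
Qed.

Section change_of_measure.
Variables (P nu : probability Omega R) (f : Omega -> R).
Hypotheses (mf : measurable_fun setT f) (f0 : forall x, (0 <= f x)%R).
Hypothesis Pf : forall phi, measurable_fun setT phi -> (forall x, 0 <= phi x) ->
  \int[P]_x phi x = \int[nu]_x (phi x * (f x)%:E).

(** The product law has density [likelihood f] with respect to the product of
    the reference probabilities. *)
Lemma ge0_integral_iid_likelihood n (phi : n.-tuple Omega -> \bar R) :
  measurable_fun setT phi -> (forall t, 0 <= phi t) ->
  \int[iid P n]_t phi t = \int[iid nu n]_t (phi t * (likelihood f t)%:E).
Proof.
have ml m : measurable_fun setT (fun t : m.-tuple Omega => (likelihood f t)%:E).
  by apply/measurable_EFinP; apply: measurable_likelihood mf.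
have l0 m (t : m.-tuple Omega) : 0 <= (likelihood f t)%:E.
  by rewrite lee_fin likelihood_ge0.
elim: n phi => [|n ih] phi mphi phi0.
  rewrite /= !integral_dirac//.
  - by rewrite /likelihood big_nil mule1.
  - exact: (emeasurable_funM mphi (ml _)).
have mphi_cons x :
    measurable_fun setT (fun t : n.-tuple Omega => phi [tuple of x :: t]).
  have mc := measurableT_comp mphi (@measurable_tuple_cons n).
  exact: (measurableT_comp mc (pair1_measurable x)).
rewrite !ge0_integral_iidS//; last 2 first.
- exact: (emeasurable_funM mphi (ml _)).
- by move=> t; rewrite mule_ge0.
under eq_integral do rewrite ih//.
rewrite Pf; last 2 first.
- apply: (measurable_fun_fubini_tonelli_F (m2 := iid nu n)
    (fun z : Omega * n.-tuple Omega =>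
      phi (tuple_cons z) * (likelihood f z.2)%:E)) => //.
  + apply: emeasurable_funM.
      exact: (measurableT_comp mphi (@measurable_tuple_cons n)).
    exact: (measurableT_comp (ml n) measurable_snd).
  + by move=> z; rewrite mule_ge0.
- by move=> x; apply: integral_ge0 => t _; rewrite mule_ge0.
apply: eq_integral => x _.
rewrite -ge0_integralZr//; last 3 first.
- exact: (emeasurable_funM (mphi_cons x) (ml n)).
- by move=> t _; rewrite mule_ge0.
- by rewrite lee_fin.
by apply: eq_integral => t _; rewrite likelihood_cons EFinM muleAC muleA.
Qed.

End change_of_measure.

(** Independence: the integral of a product over the observations is the product of
    the integrals. *)
Lemma integral_iid_likelihood nu n (h : Omega -> R) (m : R) :
  measurable_fun setT h -> (forall x, (0 <= h x)%R) ->
  \int[nu]_x (h x)%:E = m%:E ->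
  \int[iid nu n]_t (likelihood h t)%:E = (m ^+ n)%:E.
Proof.
move=> mh h0 hm.
have ml m' : measurable_fun setT (fun t : m'.-tuple Omega => (likelihood h t)%:E).
  by apply/measurable_EFinP; apply: measurable_likelihood mh.
elim: n => [|n ih].
  rewrite (eq_integral (cst 1)) => [|t _].
    by rewrite integral_cst// mul1e; exact: probability_setT.
  by rewrite tuple0 /likelihood big_nil.
rewrite ge0_integral_iidS//; last first.
  by move=> t; rewrite lee_fin likelihood_ge0.
transitivity (\int[nu]_x ((h x)%:E * (m ^+ n)%:E)).
  apply: eq_integral => x _; rewrite -ih -ge0_integralZl ?lee_fin//.
  - by apply: eq_integral => t _; rewrite likelihood_cons.
  - exact: ml.
  - by move=> t _; rewrite lee_fin likelihood_ge0.
rewrite ge0_integralZr//.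
- by rewrite hm exprS EFinM.
- exact/measurable_EFinP.
- by move=> t _; rewrite lee_fin.
- rewrite lee_fin exprn_ge0// -lee_fin -hm integral_ge0// => x _.
  by rewrite lee_fin.
Qed.

End iid_integral.

(** * The converse of Chernoff's theorem *)

Lemma exprn_powR {R : realType} (K s : R) n : 0 <= K ->
  (K ^+ n) `^ s = (K `^ s) ^+ n.
Proof.
by move=> K0; rewrite -!powR_mulrn ?powR_ge0// -!powRrM mulrC.
Qed.

(** After division by [m ^+ n], a sum of geometric sequences of ratio less than
    [1] would stay above [1]. *)
Lemma geometric_dominance {R : realType} (m a1 a2 x y : R) :
  0 < a1 < m -> 0 <= a2 < m -> 0 <= x -> 0 <= y ->
  (\forall n \near \oo, m ^+ n <= 2 * a1 ^+ n + 2 * a2 ^+ n + x ^+ n + y ^+ n) ->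
  m <= x \/ m <= y.
Proof.
move=> /andP[a1_gt0 a1m] /andP[a2_ge0 a2m] x0 y0 [n0 _ le_sum].
have [|xm] := leP m x; first by left.
have [|ym] := leP m y; first by right.
exfalso.
pose z := Num.max (Num.max a1 a2) (Num.max x y).
have zm : z < m by rewrite /z !gt_max a1m a2m xm ym.
have za1 : a1 <= z by rewrite /z !le_max lexx.
have za2 : a2 <= z by rewrite /z !le_max lexx orbT.
have zx : x <= z by rewrite /z !le_max lexx !orbT.
have zy : y <= z by rewrite /z !le_max lexx !orbT.
have z0 : 0 < z := lt_le_trans a1_gt0 za1.
have mz1 : 1 < m / z by rewrite ltr_pdivlMr ?mul1r.
have [n mzn] := exprn_gt_bound 6 mz1.
have : 6 < (m / z) ^+ (n0 + n).
  apply: lt_le_trans mzn _; rewrite exprD ler_peMl ?exprn_ge0 ?exprn_ege1 ?ltW//.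
  exact: lt_trans mz1.
rewrite exprMn exprVn ltr_pdivlMr ?exprn_gt0// ltNge => /negP; apply.
apply: le_trans (le_sum _ _) _; first by rewrite /= leq_addr.
set N := (n0 + n)%N.
have ub w : 0 <= w -> w <= z -> w ^+ N <= z ^+ N.
  by move=> w0 wz; apply: lerXn2r; rewrite // nnegrE ltW.
have := ub a1 (ltW a1_gt0) za1; have := ub _ a2_ge0 za2.
by have := ub _ x0 zx; have := ub _ y0 zy; lra.
Qed.

Section nn_integral.
Context d (T : measurableType d) (R : realType).
Variable mu : {measure set T -> \bar R}.
Implicit Types (u v : T -> R) (a b : R).

(** Measurability, sign and value are bundled so that integrals of nonnegative
    linear combinations compose without side conditions and the estimates are
    carried out in [R]. *)
Definition nn_integral u a := [/\ measurable_fun setT u, forall x, 0 <= u x &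
  (\int[mu]_x (u x)%:E = a%:E)%E].

Lemma nn_integralD u v a b : nn_integral u a -> nn_integral v b ->
  nn_integral (fun x => u x + v x) (a + b).
Proof.
move=> [mu_ u0 ua] [mv v0 vb]; split; first exact: measurable_funD.
  by move=> x; rewrite addr_ge0.
under eq_integral do rewrite EFinD.
rewrite ge0_integralD ?ua ?vb ?EFinD//; try exact/measurable_EFinP.
- by move=> x _; rewrite lee_fin.
- by move=> x _; rewrite lee_fin.
Qed.

Lemma nn_integralZ k u a : 0 <= k -> nn_integral u a ->
  nn_integral (fun x => k * u x) (k * a).
Proof.
move=> k0 [mu_ u0 ua]; split; first exact: measurable_funM.
  by move=> x; rewrite mulr_ge0.
under eq_integral do rewrite EFinM.
rewrite ge0_integralZl ?ua ?EFinM ?lee_fin//; first exact/measurable_EFinP.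
by move=> x _; rewrite lee_fin.
Qed.

Lemma nn_integral_le u v a b : nn_integral u a -> nn_integral v b ->
  (forall x, u x <= v x) -> a <= b.
Proof.
move=> [mu_ u0 ua] [mv v0 vb] uv; rewrite -lee_fin -ua -vb.
apply: ge0_le_integral => //.
- by move=> x _; rewrite lee_fin.
- exact/measurable_EFinP.
- exact/measurable_EFinP.
- by move=> x _; rewrite lee_fin.
Qed.

Lemma nn_integral_ge0 u a : nn_integral u a -> 0 <= a.
Proof.
move=> [mu_ u0 ua]; rewrite -lee_fin -ua.
by apply: integral_ge0 => x _; rewrite lee_fin.
Qed.

Lemma nn_integral_dom u v b : measurable_fun setT u -> (forall x, 0 <= u x) ->
  nn_integral v b -> (forall x, u x <= v x) ->
  nn_integral u (fine (\int[mu]_x (u x)%:E)).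
Proof.
move=> mu_ u0 [mv v0 vb] uv; split=> //.
have u_ge0 : (0 <= \int[mu]_x (u x)%:E)%E.
  by apply: integral_ge0 => x _; rewrite lee_fin.
rewrite fineK// ge0_fin_numE//; apply: le_lt_trans (ltry b); rewrite -vb.
apply: ge0_le_integral => //.
- by move=> x _; rewrite lee_fin.
- exact/measurable_EFinP.
- exact/measurable_EFinP.
- by move=> x _; rewrite lee_fin.
Qed.

End nn_integral.

Lemma measurable_gmean d (T : measurableType d) (R : realType) (u v : T -> R) s :
  measurable_fun setT u -> measurable_fun setT v ->
  measurable_fun setT (fun x => gmean s (u x) (v x)).
Proof.
move=> mu mv; rewrite /gmean; apply: measurable_funM.
- exact: (measurableT_comp (measurable_powR _) mu).
- exact: (measurableT_comp (measurable_powR _) mv).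
Qed.

Section affinity.
Context d (Omega : measurableType d) (R : realType).
Variables (P Q nu : probability Omega R) (f g : Omega -> R).
Hypotheses (mf : measurable_fun setT f) (mg : measurable_fun setT g).
Hypotheses (f0 : forall x, 0 <= f x) (g0 : forall x, 0 <= g x).
Hypothesis Pf : forall phi, measurable_fun setT phi ->
  (forall x, 0 <= phi x)%E ->
  (\int[P]_x phi x = \int[nu]_x (phi x * (f x)%:E))%E.
Hypothesis Qg : forall phi, measurable_fun setT phi ->
  (forall x, 0 <= phi x)%E ->
  (\int[Q]_x phi x = \int[nu]_x (phi x * (g x)%:E))%E.

(** The Hellinger integral of order [s]. *)
Definition affinity s : R := fine (\int[nu]_x (gmean s (f x) (g x))%:E).

Lemma nn_integral_f : nn_integral nu f 1.
Proof.
split=> //; transitivity (\int[P]_x (cst 1 x))%E.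
  by rewrite Pf//; apply: eq_integral => x _; rewrite mul1e.
by rewrite integral_cst// mul1e; exact: probability_setT.
Qed.

Lemma nn_integral_g : nn_integral nu g 1.
Proof.
split=> //; transitivity (\int[Q]_x (cst 1 x))%E.
  by rewrite Qg//; apply: eq_integral => x _; rewrite mul1e.
by rewrite integral_cst// mul1e; exact: probability_setT.
Qed.

Lemma affinityP s : 0 <= s <= 1 ->
  nn_integral nu (fun x => gmean s (f x) (g x)) (affinity s).
Proof.
move=> s01; apply: nn_integral_dom (nn_integralD nn_integral_f nn_integral_g) _.
- exact: measurable_gmean.
- by move=> x; exact: gmean_ge0.
- by move=> x; exact: gmean_leD.
Qed.

Lemma affinity_bounds s : 0 <= s <= 1 -> 0 <= affinity s <= 2.
Proof.
move=> s01; rewrite (nn_integral_ge0 (affinityP s01))/=.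
have := nn_integral_le (affinityP s01) (nn_integralD nn_integral_f nn_integral_g).
by apply=> x; exact: gmean_leD.
Qed.

Lemma affinity0 : affinity 0 = 1.
Proof.
rewrite /affinity; under eq_integral do rewrite gmean0//.
by have [_ _ ->] := nn_integral_g.
Qed.

Lemma affinity1 : affinity 1 = 1.
Proof.
rewrite /affinity; under eq_integral do rewrite gmean1//.
by have [_ _ ->] := nn_integral_f.
Qed.

Lemma affinity_convex4 s h : 0 < h -> 0 <= s - h *+ 2 -> s + h *+ 2 <= 1 ->
  4 * (affinity (s + h) + affinity (s - h))
    <= affinity (s + h *+ 2) + affinity (s - h *+ 2) + 6 * affinity s.
Proof.
move=> h0 sl sr.
have iP u : 0 <= u <= 1 -> nn_integral nu _ (affinity u) := @affinityP u.
have lhs := nn_integralZ (ler0n _ 4) (nn_integralD (iP (s + h) _) (iP (s - h) _)).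
have rhs := nn_integralD (nn_integralD (iP (s + h *+ 2) _) (iP (s - h *+ 2) _))
  (nn_integralZ (ler0n _ 6) (iP s _)).
apply: nn_integral_le (lhs _ _) (rhs _ _ _) _;
  try (move: sl sr; rewrite mulr2n; lra).
by move=> x; exact: gmean_convex4.
Qed.

Let F n := @likelihood _ Omega R n f.
Let G n := @likelihood _ Omega R n g.

Lemma affinity_iid n s : 0 <= s <= 1 ->
  nn_integral (iid nu n) (fun t => gmean s (F t) (G t)) (affinity s ^+ n).
Proof.
move=> s01; split.
- by apply: measurable_gmean; [move: mf|move: mg]; exact: measurable_likelihood.
- by move=> t; exact: gmean_ge0.
have [mfg fg0 fgE] := affinityP s01.
rewrite -(integral_iid_likelihood n mfg fg0 fgE).
by apply: eq_integral => t _; rewrite likelihood_gmean.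
Qed.

Lemma measurable_indicM n (A : set (n.-tuple Omega)) (h : Omega -> R) :
  measurable A -> measurable_fun setT h ->
  measurable_fun setT (fun t => \1_A t * likelihood h t).
Proof.
move=> mA mh; apply: measurable_funM; first exact: measurable_indic.
exact: measurable_likelihood mh.
Qed.

Lemma nn_integral_event (S : probability Omega R) (h : Omega -> R) n
    (A : set (n.-tuple Omega)) :
  measurable_fun setT h -> (forall x, 0 <= h x) ->
  (forall phi, measurable_fun setT phi -> (forall x, 0 <= phi x)%E ->
    (\int[S]_x phi x = \int[nu]_x (phi x * (h x)%:E))%E) ->
  measurable A ->
  nn_integral (iid nu n) (fun t => \1_A t * likelihood h t) (fine (iid S n A)).
Proof.
move=> mh h0 Sh mA; split.
- exact: measurable_indicM.
- by move=> t; rewrite mulr_ge0// likelihood_ge0.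
rewrite fineK; last exact: fin_num_measure.
rewrite -[in RHS](setIT A) -integral_indic// (ge0_integral_iid_likelihood mh h0 Sh).
- by apply: eq_integral => t _; rewrite EFinM.
- exact/measurable_EFinP/measurable_indic.
- by move=> t; rewrite lee_fin.
Qed.

(** The pointwise bound [gmean_split2] integrated over [n] observations: the
    minimum of the likelihoods is at most the first one on [A] and the second
    one on [B], whose integrals are the two error probabilities. *)
Lemma affinity_iid_le n (A B : set (n.-tuple Omega)) K L s t t' :
  measurable A -> measurable B -> A `|` B = setT ->
  1 <= K -> 1 <= L -> 0 < s < 1 -> 0 <= t' < s -> s < t <= 1 ->
  affinity s ^+ n <=
    (K `^ s + L `^ (1 - s)) * (fine (iid P n A) + fine (iid Q n B))
      + affinity t ^+ n / K `^ (t - s) + affinity t' ^+ n / L `^ (s - t').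
Proof.
move=> mA mB AB K1 L1 s01 t's st.
have c0 : 0 <= K `^ s + L `^ (1 - s) by rewrite addr_ge0 ?powR_ge0.
have k0 : 0 <= (K `^ (t - s))^-1 by rewrite invr_ge0 powR_ge0.
have l0 : 0 <= (L `^ (s - t'))^-1 by rewrite invr_ge0 powR_ge0.
have s01' : 0 <= s <= 1 by lra.
have t01 : 0 <= t <= 1 by lra.
have t'01 : 0 <= t' <= 1 by lra.
rewrite [_ / K `^ _]mulrC [_ / L `^ _]mulrC.
apply: (nn_integral_le (affinity_iid n s01') (nn_integralD (nn_integralD
  (nn_integralZ c0 (nn_integralD (nn_integral_event mf f0 Pf mA)
                                 (nn_integral_event mg g0 Qg mB)))
  (nn_integralZ k0 (affinity_iid n t01))) (nn_integralZ l0 (affinity_iid n t'01)))).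
move=> w; have Fw0 : 0 <= F w := likelihood_ge0 w f0.
have Gw0 : 0 <= G w := likelihood_ge0 w g0.
apply: le_trans (gmean_split2 Fw0 Gw0 K1 L1 s01 (_ : s <= t) (_ : t' <= s)) _;
  [lra|lra|].
rewrite [_ / K `^ _]mulrC [_ / L `^ _]mulrC !lerD// ler_wpM2l//.
have : (A `|` B) w by rewrite AB.
case=> [Aw|Bw].
  by rewrite indicE mem_set// mul1r ge_min lerDl mulr_ge0.
by rewrite [X in _ + X * _]indicE mem_set// mul1r ge_min lerDr mulr_ge0 ?orbT.
Qed.

(** [affinity_iid_le] with [K ^+ n] and [L ^+ n]: the hypotheses on
    [K `^ s * a] and [L `^ (1 - s) * a] make the error term negligible, so one
    of the other two terms has to dominate. *)
Lemma affinity_growth (A B : forall n, set (n.-tuple Omega)) (a : R) K L s t t' :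
  (forall n, measurable (A n)) -> (forall n, measurable (B n)) ->
  (forall n, A n `|` B n = setT) -> 0 < a ->
  (\forall n \near \oo, (iid P n (A n) <= (a ^+ n)%:E)%E /\
                         (iid Q n (B n) <= (a ^+ n)%:E)%E) ->
  1 <= K -> 1 <= L -> 0 < s < 1 -> 0 <= t' < s -> s < t <= 1 ->
  K `^ s * a < affinity s -> L `^ (1 - s) * a < affinity s ->
  K `^ (t - s) * affinity s <= affinity t \/
  L `^ (s - t') * affinity s <= affinity t'.
Proof.
move=> mA mB AB a0 [n0 _ small] K1 L1 s01 t's st Ka La.
have K0 : 0 < K by lra.
have L0 : 0 < L by lra.
have /affinity_bounds/andP[Mt0 _] : 0 <= t <= 1 by lra.
have /affinity_bounds/andP[Mt'0 _] : 0 <= t' <= 1 by lra.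
rewrite ![_ `^ _ * affinity s]mulrC -!ler_pdivlMr ?powR_gt0//.
apply: (@geometric_dominance _ _ (K `^ s * a) (L `^ (1 - s) * a)).
- by rewrite Ka mulr_gt0 ?powR_gt0.
- by rewrite La mulr_ge0 ?powR_ge0 ?ltW.
- by rewrite divr_ge0 ?powR_ge0.
- by rewrite divr_ge0 ?powR_ge0.
exists n0 => // n /= /small[PA QB].
have := affinity_iid_le (mA n) (mB n) (AB n) (exprn_ege1 n K1) (exprn_ege1 n L1)
  s01 t's st.
rewrite ![(K ^+ n) `^ _]exprn_powR ?(ltW K0)// ![(L ^+ n) `^ _]exprn_powR ?(ltW L0)//.
rewrite !exprMn !exprVn => /le_trans; apply.
rewrite 2!lerD2r.
have fPA : fine (iid P n (A n)) <= a ^+ n.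
  by rewrite -lee_fin fineK//; apply: fin_num_measure; exact: mA.
have fQB : fine (iid Q n (B n)) <= a ^+ n.
  by rewrite -lee_fin fineK//; apply: fin_num_measure; exact: mB.
have c0 : 0 <= (K `^ s) ^+ n + (L `^ (1 - s)) ^+ n.
  by rewrite addr_ge0// exprn_ge0// powR_ge0.
apply: le_trans (ler_wpM2l c0 (lerD fPA fQB)) _.
by rewrite le_eqVlt; apply/orP; left; apply/eqP; ring.
Qed.

(** The converse half of Chernoff's theorem: since the affinities stay above [b],
    no sequence of tests has both errors below [a ^+ n] with [a < b]. *)
Lemma chernoff_converse (A B : forall n, set (n.-tuple Omega)) (a b : R) :
  (forall n, measurable (A n)) -> (forall n, measurable (B n)) ->
  (forall n, A n `|` B n = setT) -> 0 < a < b ->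
  (forall s, 0 < s < 1 -> b <= affinity s) ->
  ~ (\forall n \near \oo, (iid P n (A n) <= (a ^+ n)%:E)%E /\
                           (iid Q n (B n) <= (a ^+ n)%:E)%E).
Proof.
move=> mA mB AB /andP[a0 ab] M_ge small.
apply: (@no_two_sided_growth _ affinity a b 2 a0 ab).
- by rewrite affinity0.
- by rewrite affinity1.
- exact: affinity_bounds.
- exact: M_ge.
- exact: affinity_convex4.
- by move=> K L s t t' ? ? ? ? ?; exact: (affinity_growth mA mB AB a0 small).
Qed.

End affinity.

(** * Laws with densities *)

Section two_densities.
Context d (Omega : measurableType d) (R : realType).
Variable mu : {measure set Omega -> \bar R}.
Implicit Types p q : density mu.

Definition mix_pdf p q x : R := 2^-1 * (p x + q x).

Lemma nn_integral_pdf p : nn_integral mu p 1.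
Proof. by split; [exact: pdf_measurable|exact: pdf_ge0|exact: pdf_integral]. Qed.

Lemma nn_integral_mix p q : nn_integral mu (mix_pdf p q) 1.
Proof.
have half0 : 0 <= 2^-1 :> R by rewrite invr_ge0.
have := nn_integralZ half0 (nn_integralD (nn_integral_pdf p) (nn_integral_pdf q)).
by rewrite [1 + 1](_ : _ = 2)// mulVf.
Qed.

(** Product measures require a sigma-finite reference, which [mu] may fail to
    be; the even mixture of two densities gives a probability dominating both
    laws. *)
Definition mixture p q : density mu :=
  let: And3 m ge0 int1 := nn_integral_mix p q in Density m ge0 int1.

Definition density_ratio p q x : R := p x / mixture p q x.

Lemma mixtureE p q x : mixture p q x = mix_pdf p q x.
Proof. by rewrite /mixture; case: (nn_integral_mix p q). Qed.

Lemma mixtureC p q x : mixture p q x = mixture q p x.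
Proof. by rewrite !mixtureE /mix_pdf addrC. Qed.

Lemma density_ratio_ge0 p q x : 0 <= density_ratio p q x.
Proof. by rewrite divr_ge0 ?pdf_ge0. Qed.

Lemma measurable_density_ratio p q : measurable_fun setT (density_ratio p q).
Proof.
apply: measurable_funM; first exact: pdf_measurable.
rewrite (_ : (fun _ => _) = (fun x => mixture p q x `^ (- 1))); last first.
  by apply/funext => x; rewrite powR_inv1// pdf_ge0.
exact: (measurableT_comp (measurable_powR _) (pdf_measurable (mixture p q))).
Qed.

(** Where the mixture vanishes both densities vanish, so the convention
    [x / 0 = 0] is harmless. *)
Lemma density_ratioK p q x : density_ratio p q x * mixture p q x = p x.
Proof.
rewrite /density_ratio; have [mx0|mx0] := eqVneq (mixture p q x) 0.
  have := pdf_ge0 p x; have := pdf_ge0 q x.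
  by rewrite mx0; move: mx0; rewrite mixtureE /mix_pdf; lra.
by rewrite divfK.
Qed.

Lemma ge0_integral_density_ratio p q (phi : Omega -> \bar R) :
  measurable_fun setT phi -> (forall x, 0 <= phi x)%E ->
  (\int[density_law p]_x phi x =
   \int[density_law (mixture p q)]_x (phi x * (density_ratio p q x)%:E))%E.
Proof.
move=> mphi phi0; rewrite !ge0_integral_density_law//.
- by apply: eq_integral => x _; rewrite -muleA -EFinM density_ratioK.
- apply: emeasurable_funM => //.
  exact/measurable_EFinP/measurable_density_ratio.
- by move=> x; rewrite mule_ge0 ?lee_fin ?density_ratio_ge0.
Qed.

Lemma ge0_integral_density_ratioC p q (phi : Omega -> \bar R) :
  measurable_fun setT phi -> (forall x, 0 <= phi x)%E ->
  (\int[density_law q]_x phi x =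
   \int[density_law (mixture p q)]_x (phi x * (density_ratio q p x)%:E))%E.
Proof.
move=> mphi phi0; rewrite (ge0_integral_density_ratio q p mphi phi0).
have mphir : measurable_fun setT (fun x => phi x * (density_ratio q p x)%:E)%E.
  apply: emeasurable_funM => //.
  exact/measurable_EFinP/measurable_density_ratio.
have phir0 x : (0 <= phi x * (density_ratio q p x)%:E)%E.
  by rewrite mule_ge0 ?lee_fin ?density_ratio_ge0.
rewrite (ge0_integral_density_law (mixture q p) mphir phir0).
rewrite (ge0_integral_density_law (mixture p q) mphir phir0).
by apply: eq_integral => x _; rewrite mixtureC.
Qed.

Definition density_affinity p q s : R :=
  affinity (density_law (mixture p q)) (density_ratio p q) (density_ratio q p) s.

(** The integral of [p `^ s * q `^ (1 - s)] does not depend on the reference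
    measure, since [gmean s] is homogeneous of degree [1]. *)
Lemma renyi_affinity p q s : 0 <= s <= 1 ->
  renyi s p q = (- lne (density_affinity p q s)%:E)%E.
Proof.
move=> s01; rewrite /renyi; congr (- lne _)%E.
have mp := measurable_density_ratio.
have [mg g0 <-] := affinityP (mp p q) (mp q p) (density_ratio_ge0 p q)
  (density_ratio_ge0 q p) (ge0_integral_density_ratio p q)
  (ge0_integral_density_ratioC p q) s01.
have mG : measurable_fun setT (fun x =>
    (gmean s (density_ratio p q x) (density_ratio q p x))%:E).
  exact/measurable_EFinP.
rewrite (ge0_integral_density_law (mixture p q) mG); last first.
  by move=> x; rewrite lee_fin.
apply: eq_integral => x _; rewrite -EFinM; congr EFin.
rewrite -[in RHS](gmeanxx s (pdf_ge0 (mixture p q) x)).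
rewrite -gmeanM ?density_ratio_ge0 ?pdf_ge0//.
by rewrite density_ratioK mixtureC density_ratioK.
Qed.

Lemma renyi_affinity_ge p q s (C : R) : 0 < s < 1 -> (renyi s p q <= C%:E)%E ->
  expR (- C) <= density_affinity p q s.
Proof.
move=> s01 renyiC; have s01' : 0 <= s <= 1 by lra.
have /andP[M0 _] : 0 <= density_affinity p q s <= 2.
  have mr := measurable_density_ratio.
  exact: (affinity_bounds (mr p q) (mr q p) (density_ratio_ge0 p q)
    (density_ratio_ge0 q p) (ge0_integral_density_ratio p q)
    (ge0_integral_density_ratioC p q) s01').
rewrite -lee_fin -(@lneK _ (density_affinity p q s)%:E)
  ?in_itv/= ?lee_fin ?M0 ?leey//.
by rewrite -[_%:E]/(expeR (- C)%:E) lee_expeR EFinN leeNl -renyi_affinity.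
Qed.

End two_densities.

(** * Exponential rates of estimators *)

Lemma lte_between {R : realType} (a : R) (x : \bar R) :
  (a%:E < x)%E -> exists2 c, a < c & (c%:E < x)%E.
Proof.
case: x => [r|_|//]; last by exists (a + 1); rewrite ?ltrDl// ltry.
by rewrite lte_fin => /midf_lt[am mr]; exists ((a + r) / 2).
Qed.

Lemma limn_einf_gt {R : realType} (u : (\bar R)^nat) (c : \bar R) :
  (c < limn_einf u)%E -> \forall n \near \oo, (c < u n)%E.
Proof.
rewrite /limn_einf lteNr => /ereal_inf_lt[_ [V Voo <-]] supV.
near=> n; rewrite -lteN2; apply: le_lt_trans supV.
apply: ereal_sup_ubound => /=; exists n => //.
by near: n; exact: Voo.
Unshelve. all: by end_near. Qed.

Lemma limf_esup_le {R : realType} (f : R -> \bar R) (F : set_system R)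
    (y : \bar R) :
  (\forall x \near F, (f x <= y)%E) -> (limf_esup f F <= y)%E.
Proof.
move=> Ffy; rewrite /limf_esup.
apply: (@le_trans _ _ (ereal_sup (f @` [set x | (f x <= y)%E]))).
  by apply: ereal_inf_lbound; exists [set x | (f x <= y)%E].
by apply: ge_ereal_sup => _ [x fxy <-].
Qed.

Lemma near_right0 {R : realType} (S : set R) :
  (\forall x \near 0^'+, S x) -> exists2 e : R, 0 < e & forall x, 0 < x < e -> S x.
Proof.
move=> [e /= e0 eS]; exists e => // x /andP[x0 xe].
by apply: eS => //=; rewrite sub0r normrN gtr0_norm.
Qed.

Lemma rate_gt_prob_le {R : realType} (n : nat) (c : R) (P : \bar R) :
  (0 < n)%N -> (0 <= P)%E -> (c%:E < (n%:R^-1)%:E * - lne P)%E ->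
  (P <= (expR (- c) ^+ n)%:E)%E.
Proof.
move=> n0 P0; rewrite lte_pdivlMl ?ltr0n// lteNr => /ltW lnP.
have <- : expeR (lne P) = P by rewrite lneK// in_itv/= P0 leey.
rewrite -expRM_natl -[leRHS]/(expeR (n%:R * - c)%:E) lee_expeR.
by rewrite mulrN EFinN EFinM.
Qed.

Section rate.
Context d (Omega : measurableType d) (R : realType).
Variables (mu : {measure set Omega -> \bar R}) (p : R -> density mu).

(** The miss events of the two endpoints cover the sample space, because an
    estimate at least [theta] misses [theta - eps] by [eps] and a smaller one
    misses [theta + eps].  If both rates exceeded [C], the two miss
    probabilities would be the errors of a test excluded by
    [chernoff_converse]. *)
Lemma inf_beta_le (T : estimator Omega R) (theta eps C : R) : 0 < eps ->
  (forall s, 0 < s < 1 -> (renyi s (p (theta - eps)) (p (theta + eps)) <= C%:E)%E) ->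
  (ereal_inf [set beta p T theta' eps |
     theta' in `[(theta - eps)%R, (theta + eps)%R]] <= C%:E)%E.
Proof.
move=> eps0 renyiC; rewrite leNgt; apply/negP => Cinf.
have Cbeta theta' : theta - eps <= theta' <= theta + eps ->
    (C%:E < beta p T theta' eps)%E.
  move=> h; apply: lt_le_trans Cinf _; apply: ereal_inf_lbound.
  by exists theta' => //=; rewrite in_itv.
have [] : (C%:E < Order.min (beta p T (theta - eps) eps)
                           (beta p T (theta + eps) eps))%E.
  by rewrite lt_min !Cbeta//; lra.
move=> /lte_between[c Cc]; rewrite lt_min => /andP[c1 c2].
pose miss (theta' : R) n := [set w : n.-tuple Omega | eps <= `|T n w - theta'|].
have mmiss theta' n : measurable (miss theta' n).
  rewrite -[miss _ _]setTI; apply: measurable_fun_le => //.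
  apply: measurableT_comp => //; apply: measurable_funB => //.
apply: (@chernoff_converse _ _ _ _ _ _ _ _
  (measurable_density_ratio (p (theta - eps)) (p (theta + eps)))
  (measurable_density_ratio (p (theta + eps)) (p (theta - eps)))
  (density_ratio_ge0 _ _) (density_ratio_ge0 _ _)
  (ge0_integral_density_ratio _ _) (ge0_integral_density_ratioC _ _)
  (miss (theta - eps)) (miss (theta + eps)) (expR (- c)) (expR (- C))).
- exact: mmiss.
- exact: mmiss.
- move=> n; apply/seteqP; split => // w _; rewrite /miss/=.
  have [Tw|Tw] := leP theta (T n w); [left|right].
    by apply: le_trans (ler_norm _); lra.
  by rewrite distrC; apply: le_trans (ler_norm _); lra.
- by rewrite expR_gt0 ltr_expR ltrN2.
- by move=> s s01; exact: renyi_affinity_ge (renyiC s s01).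
near=> n.
have n0 : (0 < n)%N by near: n; exact: nbhs_infty_gt.
split; apply: rate_gt_prob_le => //.
- by near: n; exact: limn_einf_gt c1.
- by near: n; exact: limn_einf_gt c2.
Unshelve. all: by end_near. Qed.

End rate.

Theorem theorem1 (R : realType) (d : measure_display)
    (Omega : measurableType d) (mu : {measure set Omega -> \bar R})
    (Theta : set R) (p : R -> density mu) (theta : R)
    (g Ig : R -> R) (kappa : R)
    (Theta_open : open Theta) (Theta_interval : is_interval Theta)
    (theta_Theta : Theta theta)
    (g_ge0 : forall x : R, 0 <= x -> 0 <= g x)
    (g_increasing : forall x y : R, 0 <= x -> x < y -> g x < g y)
    (g0 : g 0 = 0)
    (g_order : forall s : R, 0 < s < 1 ->
      exists2 c : R, 0 < c & exists2 C : R, 0 < C & \forall eps \near 0^'+,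
        ((c * g eps)%:E <= renyi s (p theta) (p (theta + eps)%R)
                        <= (C * g eps)%:E)%E)
    (Ig_lim : forall s : R, 0 < s < 1 ->
      ((g eps)^-1%:E *
         renyi s (p (theta - eps / 2)%R) (p (theta + eps / 2)%R))%E
        @[eps --> 0^'+] --> (Ig s)%:E)
    (kappa_gt0 : 0 < kappa)
    (kappa_lim : forall x : R, 0 < x ->
      g (x * eps) / g eps @[eps --> 0^'+] --> x `^ kappa)
    (Ig_uniform : forall delta : R, 0 < delta -> \forall eps \near 0^'+,
      forall s : R, 0 < s < 1 ->
        (`| (g eps)^-1%:E *
              renyi s (p (theta - eps / 2)%R) (p (theta + eps / 2)%R)
            - (Ig s)%:E | < delta%:E)%E) :
  (alpha1 p g theta
     <= (2 `^ kappa)%:E * ereal_sup [set (Ig s)%:E | s in `]0%R, 1%R[])%E.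
Proof.
set S := ereal_sup _.
have IgS s : 0 < s < 1 -> ((Ig s)%:E <= S)%E.
  by move=> s01; apply: ereal_sup_ubound; exists s => //=; rewrite in_itv.
have k0 : 0 < 2 `^ kappa :> R by rewrite powR_gt0.
have : ((Ig 2^-1)%:E <= S)%E by apply: IgS; lra.
case: S IgS => [r IgS _|_ _|//]; last first.
  by rewrite gt0_muley ?lte_fin// leey.
rewrite -EFinM; apply/lee_addgt0Pr => e e0; rewrite -EFinD.
(* Chosen so that 2 `^ kappa * delta is half the allowed error e. *)
pose delta := e / (2 `^ kappa * 2).
have delta0 : 0 < delta by rewrite divr_gt0 ?mulr_gt0.
have [eta eta0 unif] := near_right0 (Ig_uniform delta delta0).
have ratio_lt : 2 `^ kappa * (r + delta) < 2 `^ kappa * r + e.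
  have -> : 2 `^ kappa * (r + delta) = 2 `^ kappa * r + e / 2.
    by rewrite /delta; field; rewrite gt_eqF.
  by lra.
have g2 : g (2 * eps) / g eps * (r + delta) @[eps --> 0^'+] -->
    2 `^ kappa * (r + delta).
  by apply: cvgMl; apply: kappa_lim.
apply: limf_esup_le; near=> eps.
have eps0 : 0 < eps by [].
have eps_eta : 0 < 2 * eps < eta.
  rewrite mulr_gt0//= mulrC -ltr_pdivlMr//.
  by near: eps; apply: nbhs_right_lt; rewrite divr_gt0.
have ratio_eps : g (2 * eps) / g eps * (r + delta) < 2 `^ kappa * r + e.
  by near: eps; exact: cvgr_lt g2 _ ratio_lt.
have g_gt0 x : 0 < x -> 0 < g x by move=> x0; rewrite -g0 g_increasing.
have ge0 := g_gt0 _ eps0.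
rewrite lee_pdivrMl//; apply: ge_ereal_sup => _ [T _ <-].
apply: (@le_trans _ _ (g (2 * eps) * (r + delta))%:E); last first.
  rewrite -EFinM lee_fin [leRHS]mulrC -ler_pdivrMr// mulrAC; exact: ltW.
apply: inf_beta_le => // s s01.
rewrite EFinM -lee_pdivrMl ?g_gt0 ?mulr_gt0//.
have := unif _ eps_eta s s01.
have -> : 2 * eps / 2 = eps by field.
have := IgS s s01; rewrite lee_fin => Igr.
by case: (_ * _)%E => [z|//|//]; rewrite /= lte_fin lee_fin ltr_norml; lra.
Unshelve. all: by end_near. Qed.
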